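(* Let $M,\widetilde M\in\mathbb{C}^{n\times n}$ be normal matrices with eigenvalues $\lambda_j$, $\widetilde\lambda_j$ and corresponding orthonormal eigenvectors $\mathbf{u}_j$, $\widetilde{\mathbf{u}}_j$ ($j\in N=\{1,\dots,n\}$). Let $J,\widetilde J\subseteq N$ with $|J|=|\widetilde J|=q$, where $1\le q\le n-1$. Then $$d_{\mathrm{sp}}\left(\mathrm{span}(\mathbf{u}_J),\mathrm{span}(\widetilde{\mathbf{u}}_{\widetilde J})\right)\;\le\;\sqrt{\frac1q\sum_{j\in J}\frac{\left\|(\widetilde M-M)\mathbf{u}_j\right\|_2^2-\kappa_j\min_{j'\in\widetilde J}|\widetilde\lambda_{j'}-\lambda_j|^2}{\min_{j'\in\widetilde J^c}|\widetilde\lambda_{j'}-\lambda_j|^2-\kappa_j\min_{j'\in\widetilde J}|\widetilde\lambda_{j'}-\lambda_j|^2}}$$ for any choice of $$\kappa_j\in\left[0,\ \min\left(1,\left(\frac{\min_{j'\in\widetilde J^c}|\widetilde\lambda_{j'}-\lambda_j|^2}{\min_{j'\in\widetilde J}|\widetilde\lambda_{j'}-\lambda_j|^2}\right)_{-}\right)\right],\qquad j\in J.$$ Moreover, among all admissible choices of $(\kappa_j)_{j\in J}$ (when admissible choices exist), the right-hand side is smallest for the choice $$\kappa_j=\begin{cases}0,&\text{if }\|(\widetilde M-M)\mathbf{u}_j\|_2\ge\min_{j'\in\widetilde J^c}|\widetilde\lambda_{j'}-\lambda_j|,\\ 1,&\text{if }\|(\widetilde M-M)\mathbf{u}_j\|_2<\min_{j'\in\widetilde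 J^c}|\widetilde\lambda_{j'}-\lambda_j|.\end{cases}$$
   Context: For $S\subseteq N=\{1,\dots,n\}$: $\mathbf{u}_S=\{\mathbf{u}_j\mid j\in S\}$, $\widetilde{\mathbf{u}}_S=\{\widetilde{\mathbf{u}}_{j}\mid j\in S\}$, and $S^c=N\setminus S$. Spans are complex linear spans in $\mathbb{C}^n$. Eigenvalues are listed with multiplicity, and $\{\mathbf{u}_j\}_{j\in N}$, $\{\widetilde{\mathbf{u}}_j\}_{j\in N}$ are orthonormal bases of $\mathbb{C}^n$ with $M\mathbf{u}_j=\lambda_j\mathbf{u}_j$, $\widetilde M\widetilde{\mathbf{u}}_j=\widetilde\lambda_j\widetilde{\mathbf{u}}_j$. $\|\cdot\|_2$ is the Euclidean norm on vectors. Subspace distance: for $q$-dimensional subspaces $X,Y\subseteq\mathbb{C}^n$, let $\mathbf{X},\mathbf{Y}\in\mathbb{C}^{n\times q}$ be matrices whose columns are orthonormal bases of $X$ and $Y$; then $d_{\mathrm{sp}}(X,Y)=\frac{1}{\sqrt{2q}}\|\mathbf{X}\mathbf{X}^\dagger-\mathbf{Y}\mathbf{Y}^\dagger\|_F$, where $^\dagger$ is the conjugate transpose and $\|\cdot\|_F$ the Frobenius norm (this does not depend on the chosen bases). Interval notation: for $a\le\min(b,c)$, $[a,\min(b,c_-)]$ denotes $[a,b]$ if $c>b$ and $[a,c)$ if $c\le b$. A ratio $x/0$ with $x>0$ is read as $+\infty$, and the interval is read as empty if the ratio is $0/0$. Equivalently, $\kappa_j$ is admissible iff $\kappa_j\in[0,1]$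 and $\kappa_j\min_{j'\in\widetilde J}|\widetilde\lambda_{j'}-\lambda_j|^2<\min_{j'\in\widetilde J^c}|\widetilde\lambda_{j'}-\lambda_j|^2$. *)

(* Defs.v *)
From HB Require Import structures.
From mathcomp Require Import all_boot all_order all_algebra.
From mathcomp Require Import constructive_ereal reals complex.

Set Implicit Arguments.
Unset Strict Implicit.
Unset Printing Implicit Defensive.

Import Order.TTheory GRing.Theory Num.Theory.
Local Open Scope ring_scope.
Local Open Scope sesquilinear_scope.
Local Open Scope complex_scope.

(* The complex numbers are R[i] for R : realType; A ^t* is the conjugate
   transpose of A. *)

(* The modulus as an element of R (the library's `|z| lives in R[i]). *)
Definition cabs (R : realType) (z : R[i]) : R := ComplexField.Normc.normc z.

Lemma cabsE (R : realType) (z : R[i]) : (cabs z)%:C = `|z|.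
Proof. by rewrite normc_def; case: z. Qed.

Definition norm2 (R : realType) (n : nat) (v : 'cV[R[i]]_n) : R :=
  Num.sqrt (\sum_i cabs (v i 0) ^+ 2).

Definition frobenius (R : realType) (m n : nat) (A : 'M[R[i]]_(m, n)) : R :=
  Num.sqrt (\sum_i \sum_j cabs (A i j) ^+ 2).

Definition orthonormal_basis (R : realType) (n k : nat)
    (V : {vspace 'cV[R[i]]_n}) (x : 'I_k -> 'cV[R[i]]_n) : bool :=
  basis_of V [seq x i | i : 'I_k] &&
  [forall i, forall j, ((x i) ^t* *m x j) 0 0 == (i == j)%:R].

Definition onb_mx (R : realType) (n k : nat)
    (V : {vspace 'cV[R[i]]_n}) (X : 'M[R[i]]_(n, k)) : bool :=
  orthonormal_basis V (fun j => col j X).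

Lemma onb_mxP (R : realType) (n k : nat) (V : {vspace 'cV[R[i]]_n})
    (X : 'M[R[i]]_(n, k)) :
  reflect (basis_of V [seq col j X | j : 'I_k] /\ X ^t* *m X = 1%:M)
          (onb_mx V X).
Proof.
have E i j : ((col i X) ^t* *m col j X) 0 0 = (X ^t* *m X) i j.
  by rewrite !mxE; apply: eq_bigr => l _; rewrite !mxE.
apply: (iffP andP) => -[bX oX]; split=> //.
  apply/matrixP=> i j; move/forallP/(_ i)/forallP/(_ j)/eqP: oX.
  by rewrite E => ->; rewrite !mxE.
by apply/forallP=> i; apply/forallP=> j; rewrite E oX mxE.
Qed.

Lemma onb_mx_exists (R : realType) (n : nat) (V : {vspace 'cV[R[i]]_n}) :
  exists X : 'M[R[i]]_(n, \dim V), onb_mx V X.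
Proof.
pose A : 'M[R[i]]_(\dim V, n) := \matrix_(i, j) (tnth (vbasis V) i) j 0.
have dn : (\dim V <= n)%N.
  by have := dimvS (subvf V); rewrite dimvf /dim /= muln1.
have uS := schmidt_unitarymx A dn.
exists (schmidt A)^T; apply/onb_mxP; split; last first.
  rewrite -[X in X *m _]/(map_mx _ (schmidt A)^T^T) trmxK.
  have /(congr1 (map_mx Num.conj)) := unitarymxP uS.
  rewrite map_mxM map_mx1 => <-; congr (_ *m _).
  by apply/matrixP=> i j; rewrite !mxE; apply: esym; apply: conjCK.
rewrite basisEdim size_map -cardE card_ord leqnn andbT.
apply: subv_trans (_ : (<<vbasis V>> <= _)%VS).
  by rewrite (span_basis (vbasisP V)).
apply/span_subvP => v /tnthP[i ->].
have /submxP[D AE] := schmidt_sub A.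
have -> : tnth (vbasis V) i
    = \sum_j D i j *: col j (schmidt A)^T.
  apply/colP=> l; have /matrixP/(_ i l) := AE; rewrite !mxE => ->.
  by rewrite summxE; apply: eq_bigr => j _; rewrite !mxE.
apply: memv_suml => j _; apply: memvZ; apply: memv_span.
by apply/mapP; exists j; rewrite ?mem_enum.
Qed.

Lemma onb_mx_proj (R : realType) (n k l : nat) (V : {vspace 'cV[R[i]]_n})
    (X : 'M[R[i]]_(n, k)) (Y : 'M[R[i]]_(n, l)) :
  onb_mx V X -> onb_mx V Y -> X *m X ^t* = Y *m Y ^t*.
Proof.
have colM m p (A : 'M[R[i]]_(n, m)) (B : 'M[R[i]]_(m, p)) j :
    col j (A *m B) = A *m col j B by rewrite !colE mulmxA.
have key (k' l' : nat) (X' : 'M[R[i]]_(n, k')) (Y' : 'M[R[i]]_(n, l')) :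
    onb_mx V X' -> onb_mx V Y' -> X' *m X' ^t* *m Y' = Y'.
  move=> /onb_mxP[bX oX] /onb_mxP[bY _].
  suff E j : X' *m X' ^t* *m col j Y' = col j Y'.
    apply/matrixP => i j; have /colP/(_ i) := E j.
    by rewrite -colM !mxE.
  have : col j Y' \in V.
    by apply: (basis_mem bY); apply/mapP; exists j; rewrite ?mem_enum.
  rewrite -(span_basis bX) => /coord_span.
  move=> -> ; rewrite !mulmx_sumr; apply: eq_bigr => a _; rewrite -!scalemxAr.
  congr (_ *: _).
  have ak : (a < k')%N by rewrite -[X in (_ < X)%N]card_ord.
  rewrite (nth_map (Ordinal ak)) -?cardE ?card_ord //.
  by rewrite -colM -mulmxA oX mulmx1.
move=> hX hY; have XY := key _ _ _ _ hX hY; have YX := key _ _ _ _ hY hX.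
have tP m (Z : 'M[R[i]]_(n, m)) : (Z *m Z ^t*) ^t* = Z *m Z ^t*.
  by rewrite trmx_mul map_mxM trmxCK.
have E1 : Y *m Y ^t* *m (X *m X ^t*) = X *m X ^t* by rewrite mulmxA YX.
have E2 : X *m X ^t* *m (Y *m Y ^t*) = Y *m Y ^t* by rewrite mulmxA XY.
have := tP _ Y; rewrite -{1}E2 trmx_mul map_mxM !tP E1; apply.
Qed.

(* By dspE below, dsp V W is the value of the usual formula for every choice of
   orthonormal bases of V and W.  It is meant for \dim V = \dim W. *)
Definition dsp (R : realType) (n : nat) (V W : {vspace 'cV[R[i]]_n}) : R :=
  let X := xchoose (onb_mx_exists V) in
  let Y := xchoose (onb_mx_exists W) in
  1 / Num.sqrt (2 * (\dim V)%:R) * frobenius (X *m X ^t* - Y *m Y ^t*).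

Lemma dspE (R : realType) (n q : nat) (V W : {vspace 'cV[R[i]]_n})
    (X Y : 'M[R[i]]_(n, q)) : onb_mx V X -> onb_mx W Y ->
  dsp V W = 1 / Num.sqrt (2 * q%:R) * frobenius (X *m X ^t* - Y *m Y ^t*).
Proof.
move=> hX hY; rewrite /dsp.
rewrite (onb_mx_proj (xchooseP (onb_mx_exists V)) hX).
rewrite (onb_mx_proj (xchooseP (onb_mx_exists W)) hY).
have /onb_mxP[bX _] := hX.
by rewrite (size_basis (X := in_tuple _) bX) size_map -cardE card_ord.
Qed.

(* The minimum of F over A; the value 0 for A empty is a dummy. *)
Definition setmin (R : realType) (I : finType) (A : {set I}) (F : I -> R) : R :=
  if [pick i in A] is Some i0 then F [arg min_(i < i0 in A) F i]%O else 0.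

Lemma setminP (R : realType) (I : finType) (A : {set I}) (F : I -> R) :
  A != set0 ->
  exists2 i, i \in A & setmin A F = F i /\ forall j, j \in A -> F i <= F j.
Proof.
case/set0Pn=> i0 Ai0; rewrite /setmin; case: pickP => [i1 Ai1|/(_ i0)].
  by case: Order.TotalTheory.arg_minP => // i Ai mini; exists i.
by rewrite /= Ai0.
Qed.

(* [a, min (b, c_-)], for a <= min (b, c) *)
Definition itv_min_minus (R : realType) (a b : R) (c : \bar R) : interval R :=
  if (b%:E < c)%E then `[a, b] else `[a, fine c[.

(* Meant for 0 <= x and 0 <= y, not both zero. *)
Definition eratio (R : realType) (x y : R) : \bar R :=
  if y == 0 then +oo%E else (x / y)%:E.

(* kappa \in [0, min (1, (x / y)_-)]; the interval is empty for 0 / 0 *)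
Definition admissible (R : realType) (x y kappa : R) : bool :=
  ~~ ((x == 0) && (y == 0)) && (kappa \in itv_min_minus 0 1 (eratio x y)).

Lemma admissibleE (R : realType) (x y kappa : R) : 0 <= x -> 0 <= y ->
  admissible x y kappa = (0 <= kappa <= 1) && (kappa * y < x).
Proof.
move=> x0 y0; rewrite /admissible /itv_min_minus /eratio.
have [->|yN0] := eqVneq y 0.
  by rewrite /= ltry mulr0 lt_neqAle x0 !andbT andbC in_itv /= [0 == x]eq_sym.
have y_gt0 : 0 < y by rewrite lt_neqAle eq_sym yN0.
rewrite andbF /= lte_fin; case: ltP => xy; rewrite in_itv /= -ltr_pdivlMr //.
  case: (0 <= kappa) => //=; case: (leP kappa 1) => //= k1.
  by rewrite (le_lt_trans k1).
case: (0 <= kappa) => //=; case: (ltP kappa (x / y)) => k1; last by rewrite andbF.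
by rewrite andbT (le_trans (ltW k1)).
Qed.

(* Main.v *)
(* Write w_j for the squared norm of the projection of u_j onto the span of the
   ut_j' with j' outside Jt.  Then dsp^2 is the mean of the w_j over J, while
   expanding (Mt - M) u_j in the basis ut gives
   res_j^2 >= (1 - w_j) min_in + w_j min_out, hence
   w_j <= (res_j^2 - k min_in) / (min_out - k min_in) for 0 <= k <= 1.  This
   quotient is monotone in k, with the direction decided by the sign of
   res_j^2 - min_out. *)
Require Import Defs.
From HB Require Import structures.
From mathcomp Require Import all_boot all_order all_algebra.
From mathcomp Require Import constructive_ereal reals complex.
From mathcomp Require Import lra ring zify.

Set Implicit Arguments.
Unset Strict Implicit.
Unset Printing Implicit Defensive.

Import Order.TTheory GRing.Theory Num.Theory.
Local Open Scope ring_scope.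
Local Open Scope complex_scope.

(** * The modulus with values in [R] *)

Lemma cabs_ge0 (R : realType) (z : R[i]) : 0 <= cabs z.
Proof. by rewrite -lecR cabsE normr_ge0. Qed.

Lemma cabsM (R : realType) (x y : R[i]) : cabs (x * y) = cabs x * cabs y.
Proof. by apply: complexI; rewrite rmorphM /= !cabsE normrM. Qed.

Lemma sqr_cabsE (R : realType) (z : R[i]) : (cabs z ^+ 2)%:C = z * (z^*)%R.
Proof. by rewrite rmorphXn /= cabsE normCK. Qed.

(** * Frobenius norms as traces; distance between projections *)

Section Frobenius.
Variable R : realType.
Local Notation C := R[i].
Local Open Scope sesquilinear_scope.

Lemma sqr_frobenius_sum m n (A : 'M[C]_(m, n)) :
  frobenius A ^+ 2 = \sum_i \sum_j cabs (A i j) ^+ 2.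
Proof.
by rewrite sqr_sqrtr //; do 2 apply: sumr_ge0 => ? _; rewrite exprn_ge0 ?cabs_ge0.
Qed.

Lemma sqr_frobenius_trace m n (A : 'M[C]_(m, n)) :
  (frobenius A ^+ 2)%:C = \tr (A *m A ^t*).
Proof.
rewrite sqr_frobenius_sum rmorph_sum; apply: eq_bigr => i _ /=.
rewrite rmorph_sum mxE; apply: eq_bigr => j _ /=.
by rewrite sqr_cabsE !mxE.
Qed.

Lemma adjmxM m n p (A : 'M[C]_(m, n)) (B : 'M[C]_(n, p)) :
  (A *m B) ^t* = B ^t* *m A ^t*.
Proof. by rewrite trmx_mul map_mxM. Qed.

(** In trace form, cyclicity brings [U] and [U ^t*] together, where they cancel. *)
Lemma sqr_frobenius_unitary m n (U : 'M[C]_m) (A : 'M[C]_(m, n)) :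
  U *m U ^t* = 1%:M -> frobenius (U ^t* *m A) ^+ 2 = frobenius A ^+ 2.
Proof.
move=> UU; apply: complexI; rewrite !sqr_frobenius_trace adjmxM trmxCK.
by rewrite mxtrace_mulC mulmxA -(mulmxA _ U) UU mulmx1 mxtrace_mulC.
Qed.

Lemma mxtraceB n (A B : 'M[C]_n) : \tr (A - B) = \tr A - \tr B.
Proof. exact: raddfB. Qed.

Lemma norm2_frobenius n (v : 'cV[C]_n) : norm2 v = frobenius v.
Proof.
by congr Num.sqrt; apply: eq_bigr => i _; rewrite big_ord1.
Qed.

(** With P = X X^* and Q = Y Y^*, the square is tr (P - Q)^2 = tr P + tr Q - 2 tr (P Q), and by
    cyclicity tr (P Q) is the squared Frobenius norm of Y^* X, whose entries are inner products of
    basis vectors. *)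
Lemma sqr_frobenius_subproj n k l (X : 'M[C]_(n, k)) (Y : 'M[C]_(n, l)) :
  X ^t* *m X = 1%:M -> Y ^t* *m Y = 1%:M ->
  frobenius (X *m X ^t* - Y *m Y ^t*) ^+ 2 =
    k%:R + l%:R - 2 * frobenius (Y ^t* *m X) ^+ 2.
Proof.
move=> XX YY; apply: complexI.
rewrite [RHS]rmorphB rmorphD [in RHS]rmorphM /= !rmorph_nat.
rewrite !sqr_frobenius_trace.
rewrite [(_ - _)^T]raddfB map_mxB !adjmxM !trmxCK mulmxBl !mulmxBr.
rewrite [LHS]mxtraceB [X in X - _ = _]mxtraceB [X in _ - X = _]mxtraceB.
rewrite !mulmxA -(mulmxA X) XX -(mulmxA Y _ Y) YY !mulmx1.
rewrite (mxtrace_mulC X) XX (mxtrace_mulC Y (Y ^t*)) YY !mxtrace1.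
have -> : \tr (Y *m Y ^t* *m X *m X ^t*) = \tr (Y ^t* *m X *m X ^t* *m Y).
  by rewrite -!mulmxA mxtrace_mulC !mulmxA.
have -> : \tr (X *m X ^t* *m Y *m Y ^t*) = \tr (Y ^t* *m X *m X ^t* *m Y).
  by rewrite mxtrace_mulC !mulmxA.
ring.
Qed.

(** * Vector families as matrices; spans of subfamilies of an orthonormal basis *)

Definition colsmx n k (x : 'I_k -> 'cV[C]_n) : 'M[C]_(n, k) :=
  \matrix_(i, j) x j i 0.

Lemma col_colsmx n k (x : 'I_k -> 'cV[C]_n) j : col j (colsmx x) = x j.
Proof. by apply/colP => i; rewrite !mxE. Qed.

Lemma colsmx_gram n k l (x : 'I_k -> 'cV[C]_n) (y : 'I_l -> 'cV[C]_n) i j :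
  ((colsmx x) ^t* *m colsmx y) i j = ((x i) ^t* *m y j) 0 0.
Proof. by rewrite !mxE; apply: eq_bigr => a _; rewrite !mxE. Qed.

Lemma orthonormal_basis_gram n k V (x : 'I_k -> 'cV[C]_n) :
  orthonormal_basis V x -> (colsmx x) ^t* *m colsmx x = 1%:M.
Proof.
case/andP=> _ /forallP o; apply/matrixP => i j.
by rewrite colsmx_gram [RHS]mxE; have /forallP/(_ j)/eqP := o i.
Qed.

Lemma onb_mx_span n k V (x : 'I_k -> 'cV[C]_n) (A : {set 'I_k}) :
  orthonormal_basis V x ->
  onb_mx <<[seq x j | j in A]>> (colsmx (fun a : 'I_#|A| => x (enum_val a))).
Proof.
move=> ox; have /andP[bx /forallP o] := ox; apply/onb_mxP; split; last first.
  apply/matrixP => a b; rewrite colsmx_gram [RHS]mxE -(inj_eq enum_val_inj).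
  by have /forallP/(_ (enum_val b))/eqP := o (enum_val a).
have -> : [seq col a (colsmx (fun a : 'I_#|A| => x (enum_val a))) | a : 'I_#|A|]
     = [seq x j | j in A].
  apply: (@eq_from_nth _ 0) => [|a]; rewrite !size_image card_ord // => ltaA.
  pose j0 := enum_val (Ordinal ltaA).
  rewrite (nth_map (Ordinal ltaA)) -?cardE ?card_ord // col_colsmx.
  by rewrite (nth_map j0) -?cardE // (enum_val_nth j0) nth_enum_ord.
rewrite /basis_of eqxx /=.
(* Listing [A] and then its complement permutes the whole basis, so the concatenation is free, and
   so is its left part. *)
have : free (image x A ++ image x [predC A]).
  rewrite -map_cat (@perm_free _ _ _ (map x (enum 'I_k))) ?(basis_free bx) //.
  by apply: perm_map; rewrite enumT; apply/permPl/perm_filterC.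
exact: catl_free.
Qed.

(** * Overlaps between the two eigenbases *)

Definition overlap n (u ut : 'I_n -> 'cV[C]_n) (j' j : 'I_n) : R :=
  cabs (((ut j') ^t* *m u j) 0 0) ^+ 2.

Lemma overlap_ge0 n (u ut : 'I_n -> 'cV[C]_n) j' j : 0 <= overlap u ut j' j.
Proof. by rewrite exprn_ge0 ?cabs_ge0. Qed.

(** Parseval: the matrix of an orthonormal basis is unitary, so passing to coordinates preserves the
    norm. *)
Lemma sqr_norm2_onb n (e : 'I_n -> 'cV[C]_n) (v : 'cV[C]_n) :
  orthonormal_basis fullv e ->
  norm2 v ^+ 2 = \sum_i cabs (((e i) ^t* *m v) 0 0) ^+ 2.
Proof.
move=> /orthonormal_basis_gram /mulmx1C ee.
rewrite norm2_frobenius -(sqr_frobenius_unitary _ ee) sqr_frobenius_sum.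
apply: eq_bigr => i _; rewrite big_ord1; congr (cabs _ ^+ 2).
by rewrite !mxE; apply: eq_bigr => a _; rewrite !mxE.
Qed.

Lemma sum_overlap n (u ut : 'I_n -> 'cV[C]_n) j :
  orthonormal_basis fullv u -> orthonormal_basis fullv ut ->
  \sum_j' overlap u ut j' j = 1.
Proof.
move=> ou out; rewrite -(sqr_norm2_onb _ out) norm2_frobenius.
apply: complexI; rewrite sqr_frobenius_trace mxtrace_mulC.
case/andP: ou => _ /forallP o; rewrite /mxtrace big_ord1.
by have /forallP/(_ j)/eqP -> := o j; rewrite eqxx.
Qed.

Lemma sum_overlapC n (u ut : 'I_n -> 'cV[C]_n) (A : {set 'I_n}) j :
  orthonormal_basis fullv u -> orthonormal_basis fullv ut ->
  \sum_(j' in ~: A) overlap u ut j' j = 1 - \sum_(j' in A) overlap u ut j' j.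
Proof.
move=> ou out.
rewrite -(sum_overlap j ou out) [X in _ = X - _](bigID (mem A)) /= addrAC subrr.
by rewrite add0r; apply: eq_bigl => i; rewrite inE.
Qed.

(** Each [u j] has total overlap 1, so 2q minus twice the overlaps inside [Jt] is twice the overlaps
    outside; this 2 cancels against the factor 1/(2q). *)
Lemma sqr_dsp_overlap n q (u ut : 'I_n -> 'cV[C]_n) (J Jt : {set 'I_n}) :
  orthonormal_basis fullv u -> orthonormal_basis fullv ut ->
  (0 < q)%N -> #|J| = q -> #|Jt| = q ->
  dsp <<[seq u j | j in J]>> <<[seq ut j | j in Jt]>> ^+ 2 =
    1 / q%:R * \sum_(j in J) \sum_(j' in ~: Jt) overlap u ut j' j.
Proof.
move=> ou out q0 cJ cJt.
have oX := onb_mx_span J ou; have oY := onb_mx_span Jt out.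
have /onb_mxP[bX XX] := oX; have /onb_mxP[_ YY] := oY.
rewrite /dsp (onb_mx_proj (xchooseP (onb_mx_exists _)) oX).
rewrite (onb_mx_proj (xchooseP (onb_mx_exists _)) oY).
have -> : \dim <<[seq u j | j in J]>> = q.
  by rewrite (size_basis (X := in_tuple _) bX) size_map -cardE card_ord.
rewrite exprMn sqr_frobenius_subproj // sqr_frobenius_sum exchange_big /=.
have -> : \sum_(j < #|J|) \sum_(i < #|Jt|)
      cabs (((colsmx (fun a : 'I_#|Jt| => ut (enum_val a))) ^t* *m
             colsmx (fun a : 'I_#|J| => u (enum_val a))) i j) ^+ 2
   = \sum_(j in J) \sum_(j' in Jt) overlap u ut j' j.
  rewrite [RHS]big_enum_val; apply: eq_bigr => j _.
  rewrite [RHS]big_enum_val; apply: eq_bigr => i _.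
  by rewrite colsmx_gram.
under [in RHS]eq_bigr do rewrite (sum_overlapC _ _ ou out).
rewrite sumrB sumr_const cJ cJt expr_div_n sqr_sqrtr; last first.
  by rewrite mulr_ge0 ?ler0n.
field; rewrite pnatr_eq0 -lt0n q0 //.
Qed.

(** * Coordinates of the residual in the basis [ut] *)

(** Applied to any [e i], both rows give [l j] if i = j and 0 otherwise; rows that agree on a basis
    are equal. *)
Lemma orthonormal_eigenbasis_adj n (A : 'M[C]_n) (l : 'I_n -> C) e j :
  orthonormal_basis fullv e -> (forall j, A *m e j = l j *: e j) ->
  (e j) ^t* *m A = l j *: (e j) ^t*.
Proof.
move=> oe Ae; have ee := mulmx1C (orthonormal_basis_gram oe).
case/andP: oe => _ /forallP o.
have inj (v w : 'rV_n) : v *m colsmx e = w *m colsmx e -> v = w.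
  by move/(congr1 (mulmx^~ (colsmx e ^t*))); rewrite -!mulmxA ee !mulmx1.
apply: inj; apply/rowP => i.
have colM (v : 'rV_n) : (v *m colsmx e) 0 i = (v *m e i) 0 0.
  by rewrite !mxE; apply: eq_bigr => a _; rewrite mxE.
rewrite !colM -mulmxA Ae -scalemxAr -scalemxAl [LHS]mxE [RHS]mxE.
have /forallP/(_ i)/eqP -> := o j.
by case: eqVneq => [->|_] //; rewrite !mulr0.
Qed.

(** [Mt] acts to the left on [(ut j') ^t*] and [M] to the right on [u j], which leaves the
    difference of eigenvalues as a factor. *)
Lemma cabs_residual n (M Mt : 'M[C]_n) (lam lamt : 'I_n -> C)
    (u ut : 'I_n -> 'cV[C]_n) j' j :
  orthonormal_basis fullv ut ->
  (forall j, M *m u j = lam j *: u j) ->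
  (forall j, Mt *m ut j = lamt j *: ut j) ->
  cabs (((ut j') ^t* *m ((Mt - M) *m u j)) 0 0) ^+ 2 =
    cabs (lamt j' - lam j) ^+ 2 * overlap u ut j' j.
Proof.
move=> out Mu Mtut.
rewrite mulmxBl mulmxBr Mu -scalemxAr mulmxA (orthonormal_eigenbasis_adj _ out Mtut).
by rewrite -scalemxAl -scalerBl mxE cabsM exprMn.
Qed.

End Frobenius.

(** * Scalar inequalities, with [a] for [min_in], [b] for [min_out], [r] for the squared residual *)

Lemma residual_ratio_le (R : realFieldType) (w r a b k : R) :
  0 <= k <= 1 -> 0 <= a -> k * a < b -> 0 <= w <= 1 ->
  a * (1 - w) + b * w <= r -> w <= (r - k * a) / (b - k * a).
Proof.
move=> /andP[k0 k1] a0 kab /andP[w0 w1] hr.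
rewrite ler_pdivlMr ?subr_gt0 //.
(* This is the slack left after clearing the denominator and inserting the lower bound on [r]. *)
have : 0 <= (1 - k) * (a * (1 - w)) by rewrite !mulr_ge0 ?subr_ge0.
by nra.
Qed.

Lemma ratio_shift_mono (R : realFieldType) (r a b k : R) :
  0 <= k <= 1 -> 0 <= a -> k * a < b -> b <= r ->
  (r - 0 * a) / (b - 0 * a) <= (r - k * a) / (b - k * a).
Proof.
move=> /andP[k0 k1] a0 kab br; have ka0 : 0 <= k * a by rewrite mulr_ge0.
have b0 : 0 < b by apply: le_lt_trans kab.
rewrite mul0r !subr0 ler_pdivrMr // mulrAC ler_pdivlMr ?subr_gt0 //.
(* Exactly the difference of the cross-multiplied sides. *)
have : 0 <= (k * a) * (r - b) by rewrite mulr_ge0 ?subr_ge0.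
by nra.
Qed.

Lemma ratio_shift_anti (R : realFieldType) (r a b k : R) :
  0 <= k <= 1 -> 0 <= a -> a < b -> r <= b ->
  (r - 1 * a) / (b - 1 * a) <= (r - k * a) / (b - k * a).
Proof.
move=> /andP[k0 k1] a0 ab rb; have kab : k * a < b by nra.
rewrite mul1r ler_pdivrMr ?subr_gt0 // mulrAC ler_pdivlMr ?subr_gt0 //.
(* Again the difference of the cross-multiplied sides. *)
have : 0 <= ((1 - k) * a) * (b - r) by rewrite !mulr_ge0 ?subr_ge0.
by nra.
Qed.

(** * Minima over nonempty sets *)

Lemma setmin_sqr (R : realType) (I : finType) (A : {set I}) (F : I -> R) :
  A != set0 -> (forall i, 0 <= F i) ->
  setmin A (fun i => F i ^+ 2) = setmin A F ^+ 2.
Proof.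
move=> A0 F0; have [i iA [-> mi]] := setminP (fun i => F i ^+ 2) A0.
have [j jA [-> mj]] := setminP F A0.
by apply: le_anti; rewrite mi // ler_sqr ?nnegrE // mj.
Qed.

Lemma setmin_ge0 (R : realType) (I : finType) (A : {set I}) (F : I -> R) :
  A != set0 -> (forall i, 0 <= F i) -> 0 <= setmin A F.
Proof. by move=> A0 F0; have [i _ [->]] := setminP F A0. Qed.

Lemma setmin_le_wsum (R : realType) (I : finType) (A : {set I}) (F w : I -> R) :
  A != set0 -> (forall i, 0 <= w i) ->
  setmin A F * \sum_(i in A) w i <= \sum_(i in A) F i * w i.
Proof.
move=> A0 w0; have [i _ [-> mi]] := setminP F A0; rewrite mulr_sumr.
by apply: ler_sum => j jA; rewrite ler_wpM2r // mi.
Qed.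

(** * The bound on [dsp] and the optimal weights *)

Theorem proposition1 (R : realType) (n q : nat) (M Mt : 'M[R[i]]_n)
    (lam lamt : 'I_n -> R[i]) (u ut : 'I_n -> 'cV[R[i]]_n)
    (J Jt : {set 'I_n}) :
  M \is normalmx -> Mt \is normalmx ->
  orthonormal_basis fullv u -> (forall j, M *m u j = lam j *: u j) ->
  orthonormal_basis fullv ut -> (forall j, Mt *m ut j = lamt j *: ut j) ->
  (1 <= q <= n - 1)%N -> #|J| = q -> #|Jt| = q ->
  let min_in j := setmin Jt (fun j' => cabs (lamt j' - lam j) ^+ 2) in
  let min_out j := setmin (~: Jt) (fun j' => cabs (lamt j' - lam j) ^+ 2) in
  let res j := norm2 ((Mt - M) *m u j) in
  let bound (kappa : 'I_n -> R) :=
    Num.sqrt (1 / q%:R * \sum_(j in J)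
      (res j ^+ 2 - kappa j * min_in j) / (min_out j - kappa j * min_in j)) in
  let adm (kappa : 'I_n -> R) :=
    forall j, j \in J -> admissible (min_out j) (min_in j) (kappa j) in
  let kappa_opt j : R :=
    if res j >= setmin (~: Jt) (fun j' => cabs (lamt j' - lam j)) then 0 else 1
  in
  (forall kappa, adm kappa ->
     dsp <<[seq u j | j in J]>>%VS <<[seq ut j | j in Jt]>>%VS <= bound kappa)
  /\
  ((exists kappa, adm kappa) ->
     adm kappa_opt /\ forall kappa, adm kappa -> bound kappa_opt <= bound kappa).
Proof.
move=> _ _ ou Mu out Mtut /andP[q0 qn] cJ cJt min_in min_out res bound adm kopt.
(* The bounds on [q] make [Jt] and its complement nonempty, so the dummy value of [setmin] never
   occurs. *)
have Jt0 : Jt != set0 by rewrite -card_gt0 cJt.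
have Jtc0 : ~: Jt != set0.
  by have := cardsC Jt; rewrite cJt card_ord -card_gt0; lia.
pose w j := \sum_(j' in ~: Jt) overlap u ut j' j.
have sumw j : \sum_(j' in Jt) overlap u ut j' j = 1 - w j.
  by rewrite /w (sum_overlapC _ _ ou out) subKr.
have w01 j : 0 <= w j <= 1.
  rewrite sumr_ge0 /=; last by move=> *; exact: overlap_ge0.
  by rewrite -subr_ge0 -sumw sumr_ge0 // => *; exact: overlap_ge0.
(* Parseval in [ut], split along [Jt]; on each side the eigenvalue gaps are bounded below by their
   minimum. *)
have res_ge j : min_in j * (1 - w j) + min_out j * w j <= res j ^+ 2.
  rewrite /res (sqr_norm2_onb _ out).
  under eq_bigr do rewrite (cabs_residual _ _ out Mu Mtut).
  rewrite (bigID (mem Jt)) /= -sumw lerD ?setmin_le_wsum // => *;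
    rewrite ?overlap_ge0 //.
  rewrite [leRHS](eq_bigl (mem (~: Jt))); last by move=> i /=; rewrite inE.
  by apply: setmin_le_wsum => // *; exact: overlap_ge0.
have in_ge0 j : 0 <= min_in j by apply: setmin_ge0 => // i; rewrite sqr_ge0.
have out_ge0 j : 0 <= min_out j by apply: setmin_ge0 => // i; rewrite sqr_ge0.
have min_outE j : min_out j = setmin (~: Jt) (fun j' => cabs (lamt j' - lam j)) ^+ 2.
  by apply: setmin_sqr => // i; exact: cabs_ge0.
have q1 : 0 <= 1 / q%:R :> R by rewrite divr_ge0 ?ler0n.
have koptE j : kopt j = if min_out j <= res j ^+ 2 then 0 else 1.
  rewrite /kopt min_outE ler_sqr ?nnegrE ?sqrtr_ge0 //.
  by apply: setmin_ge0 => // i; exact: cabs_ge0.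
(* Otherwise the convex combination in [res_ge] would be at least [min_out j]. *)
have in_lt_out j : res j ^+ 2 < min_out j -> min_in j < min_out j.
  move=> rlt; case: (ltP (min_in j) (min_out j)) => // oi.
  by have := res_ge j; have := w01 j; move: (w j) => x; nra.
split=> [kappa ak|[k0 ak0]].
  rewrite -(ler_sqr (x := dsp _ _)) ?nnegrE ?sqrtr_ge0 //; last first.
    by rewrite mulr_ge0 ?sqrtr_ge0 // divr_ge0 ?sqrtr_ge0.
  have Hle : 1 / q%:R * \sum_(j in J) w j <= 1 / q%:R * \sum_(j in J)
      (res j ^+ 2 - kappa j * min_in j) / (min_out j - kappa j * min_in j).
    rewrite ler_wpM2l //; apply: ler_sum => j jJ.
    have := ak j jJ; rewrite admissibleE // => /andP[k01 kab].
    exact: residual_ratio_le.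
  rewrite (sqr_dsp_overlap ou out q0 cJ cJt) sqr_sqrtr //.
  (* Remaining side condition: the radicand is nonnegative, since it dominates the mean of the
     [w j]. *)
  apply: le_trans Hle; rewrite mulr_ge0 // sumr_ge0 // => j _.
  by case/andP: (w01 j).
split=> [j jJ|kappa ak].
  (* The value 0 requires [0 < min_out j], which the given admissible [k0] provides; the value 1
     requires [min_in j < min_out j]. *)
  have := ak0 j jJ; rewrite !admissibleE // koptE => /andP[/andP[k00 _] kab].
  case: ifPn => [_|]; first by rewrite lexx ler01 mul0r (le_lt_trans _ kab) ?mulr_ge0.
  by rewrite -ltNge => /in_lt_out lt; rewrite lexx ler01 mul1r.
(* Each [kappa j] enters only its own summand, so the comparison is made term by term. *)
rewrite ler_wsqrtr // ler_wpM2l //; apply: ler_sum => j jJ.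
have := ak j jJ; rewrite admissibleE // => /andP[k01 kab]; rewrite koptE.
case: ifPn => [le|]; first exact: ratio_shift_mono.
rewrite -ltNge => lt; apply: ratio_shift_anti => //; first exact: in_lt_out.
exact: ltW.
Qed.
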